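(* Let $A_1$ and $A_2$ be unital $C^*$-algebras and let $B_1\subseteq A_1$ and $B_2\subseteq A_2$ be $C^*$-subalgebras containing the identities of $A_1$ and $A_2$ respectively. If both $(A_1,B_1)$ and $(A_2,B_2)$ have property $(T)$ (respectively, strong property $(T)$), then so does $(A_1\oplus A_2,B_1\oplus B_2)$.
   Context: Let $A$ be a unital $C^*$-algebra and $B\subseteq A$ a $C^*$-subalgebra containing the identity of $A$. A unital Hilbert bimodule over $A$ is a Hilbert space $H$ with commuting unital left and right actions of $A$ coming from a non-degenerate $*$-representation of $A\otimes_{\max}A^{\rm op}$, with $(a\otimes b^{\rm op})\xi=a\cdot\xi\cdot b$ ($A^{\rm op}$ is the opposite $C^*$-algebra). For such $H$, $H^B:=\{\xi\in H: b\cdot\xi=\xi\cdot b\text{ for all }b\in B\}$ and $P^B_H:H\to H^B$ is the orthogonal projection. For a non-empty finite $Q\subseteq A$ and $\beta>0$, $V_H(Q,\beta):=\{\xi\in H:\|\xi\|=1,\ \|x\cdot\xi-\xi\cdot x\|<\beta\text{ for all }x\in Q\}$. The pair $(A,B)$ has property $(T)$ if there exist a non-empty finite $F\subseteq A$ and $\epsilon>0$ such that for any unital Hilbert bimodule $H$ over $A$, $V_H(F,\epsilon)\neq\emptyset$ implies $H^B\neq\{0\}$. The pair $(A,B)$ has strong property $(T)$ if for any $\alpha>0$ there exist a non-empty finite $Q\subseteq A$ and $\beta>0$ such that for any unital Hilbert bimodule $H$ over $A$ and any $\xi\in V_H(Q,\beta)$, $\|\xi-P^B_H(\xi)\|<\alpha$.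 *)

(* Defs.v *)
(* The complex numbers are R[i] with R : realType;
   norms of normed R[i]-modules take values in R[i], hence the casts _%:C. *)
From HB Require Import structures.
From mathcomp Require Import all_boot all_order all_algebra.
From mathcomp Require Import all_classical all_reals all_analysis.
From mathcomp Require Import complex.

Set Implicit Arguments.
Unset Strict Implicit.
Unset Printing Implicit Defensive.

Import Order.TTheory GRing.Theory Num.Theory.
Import numFieldNormedType.Exports.

Local Open Scope classical_set_scope.
Local Open Scope ring_scope.
Local Open Scope complex_scope.

(* Unital C*-algebras; the zero algebra is allowed. Unit and product are fields
   of the mixin because the library has no structure joining rings and normed
   modules below numDomainType; the ring structure is recovered just after. *)
HB.mixin Record isCStarAlgebra (R : realType) A
    of CompleteNormedModule R[i] A := {
  csone : A ;
  csmul : A -> A -> A ;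
  star : A -> A ;
  csmulA : associative csmul ;
  csmul1l : left_id csone csmul ;
  csmul1r : right_id csone csmul ;
  csmulDl : left_distributive csmul +%R ;
  csmulDr : right_distributive csmul +%R ;
  csscalerAl : forall (c : R[i]) (x y : A),
    c *: csmul x y = csmul (c *: x) y ;
  csscalerAr : forall (c : R[i]) (x y : A),
    c *: csmul x y = csmul x (c *: y) ;
  csnormM : forall x y : A, `|csmul x y| <= `|x| * `|y| ;
  starK : involutive star ;
  star_antilinear : forall (c : R[i]) (x y : A),
    star (c *: x + y) = c^* *: star x + star y ;
  csstarM : forall x y : A, star (csmul x y) = csmul (star y) (star x) ;
  csnorm_star : forall x : A, `|csmul (star x) x| = `|x| ^+ 2
}.

#[short(type="cstarAlgType")]
HB.structure Definition CStarAlgebra (R : realType) :=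
  {A of CompleteNormedModule R[i] A & isCStarAlgebra R A}.

HB.instance Definition _ (R : realType) (A : cstarAlgType R) :=
  GRing.Zmodule_isPzRing.Build A
    csmulA csmul1l csmul1r csmulDl csmulDr.

HB.mixin Record isHilbert (R : realType) H of CompleteNormedModule R[i] H := {
  inner : H -> H -> R[i] ;
  inner_linearl : forall (c : R[i]) (x y z : H),
    inner (c *: x + y) z = c * inner x z + inner y z ;
  inner_conj : forall x y : H, inner y x = (inner x y)^* ;
  inner_norm : forall x : H, inner x x = `|x| ^+ 2
}.

#[short(type="hilbertType")]
HB.structure Definition Hilbert (R : realType) :=
  {H of CompleteNormedModule R[i] H & isHilbert R H}.

(* The opposite C*-algebra A^c : MathComp's converse ring, with the linear,
   normed and star structures of A. *)
Section Opposite.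
Variables (R : realType) (A : cstarAlgType R).

HB.instance Definition _ := CompleteNormedModule.copy A^c A.

Definition op_mul (x y : A) : A := csmul y x.

Let op_mulA : associative op_mul.
Proof. by move=> x y z; rewrite /op_mul csmulA. Qed.

Let op_normM (x y : A) : `|op_mul x y| <= `|x| * `|y|.
Proof. by rewrite mulrC csnormM. Qed.

Let op_starM (x y : A) : star (op_mul x y) = op_mul (star y) (star x).
Proof. exact: csstarM. Qed.

Let op_norm_star (x : A) : `|op_mul (star x) x| = `|x| ^+ 2.
Proof.
have := csnorm_star (star x); rewrite starK /op_mul => ->.
have h (z : A) : `|z| <= `|star z|.
  have := csnormM (star z) z; rewrite csnorm_star expr2.
  have [->|z0] := eqVneq z 0; first by rewrite normr0.
  by rewrite ler_pM2r// normr_gt0.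
congr (_ ^+ 2); apply/le_anti/andP; split; last exact: h.
by have := h (star x); rewrite starK.
Qed.

HB.instance Definition _ := isCStarAlgebra.Build R A^c
  op_mulA csmul1r csmul1l (fun x y z => csmulDr z x y) (fun x y z => csmulDl y z x)
  (fun c x y => csscalerAr c y x) (fun c x y => csscalerAl c y x)
  op_normM (@starK R A) (@star_antilinear R A) op_starM op_norm_star.

End Opposite.

HB.instance Definition _ (K : numFieldType) (U V : completeNormedModType K) :=
  Pointed.on (U * V)%type.

Lemma prod_complete (K : numFieldType) (U V : completeNormedModType K)
    (F : set_system (U * V)) :
  ProperFilter F -> cauchy F -> cvg F.
Proof.
move=> PF cF.
have c1 : cauchy (fst @ F).
  move=> E entE.
  have [|[P Q] /= [FP FQ] PQ] := cF [set p | E (p.1.1, p.2.1)].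
    exists (E, setT); first by split => //; exact: entourageT.
    by move=> [[a b] [c d]] [] /= ? ?; exists ((a, c), (b, d)).
  exists (fst @` P, fst @` Q) => /=.
    by split; [apply: filterS FP|apply: filterS FQ] => x ?; exists x.
  by case=> _ _ /= [[x Px <-] [y Qy <-]]; exact: (PQ (x, y)).
have c2 : cauchy (snd @ F).
  move=> E entE.
  have [|[P Q] /= [FP FQ] PQ] := cF [set p | E (p.1.2, p.2.2)].
    exists (setT, E); first by split => //; exact: entourageT.
    by move=> [[a b] [c d]] [] /= ? ?; exists ((a, c), (b, d)).
  exists (snd @` P, snd @` Q) => /=.
    by split; [apply: filterS FP|apply: filterS FQ] => x ?; exists x.
  by case=> _ _ /= [[x Px <-] [y Qy <-]]; exact: (PQ (x, y)).
have Fa : cvg (fst @ F) by exact: cauchy_cvg c1.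
have Fb : cvg (snd @ F) by exact: cauchy_cvg c2.
apply/cvg_ex; exists (lim (fst @ F), lim (snd @ F)).
move=> S [[P Q] /= [Pa Qb] PQS].
have FP : F (fst @^-1` P) by exact: Fa.
have FQ : F (snd @^-1` Q) by exact: Fb.
by apply: filterS (filterI FP FQ) => -[x y] /= [Px Qy]; exact: PQS.
Qed.

HB.instance Definition _ (K : numFieldType) (U V : completeNormedModType K) :=
  Uniform_isComplete.Build (U * V)%type (@prod_complete K U V).

(* The direct sum of C*-algebras: the product type, with componentwise
   operations and the library's maximum norm. *)
Section DirectSum.
Variables (R : realType) (A1 A2 : cstarAlgType R).
Local Notation A := (A1 * A2)%type.

Definition prod_one : A := (csone, csone).
Definition prod_mul (x y : A) : A := (csmul x.1 y.1, csmul x.2 y.2).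
Definition prod_star (x : A) : A := (star x.1, star x.2).

Let prod_mulA : associative prod_mul.
Proof. by move=> x y z; congr pair; rewrite /= csmulA. Qed.

Let prod_mul1l : left_id prod_one prod_mul.
Proof. by case=> a b; congr pair; rewrite /= csmul1l. Qed.

Let prod_mul1r : right_id prod_one prod_mul.
Proof. by case=> a b; congr pair; rewrite /= csmul1r. Qed.

Let prod_mulDl : left_distributive prod_mul +%R.
Proof. by move=> x y z; congr pair; rewrite /= csmulDl. Qed.

Let prod_mulDr : right_distributive prod_mul +%R.
Proof. by move=> x y z; congr pair; rewrite /= csmulDr. Qed.

Let prod_scalerAl (c : R[i]) (x y : A) :
  c *: prod_mul x y = prod_mul (c *: x) y.
Proof. by congr pair; rewrite /= csscalerAl. Qed.

Let prod_scalerAr (c : R[i]) (x y : A) :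
  c *: prod_mul x y = prod_mul x (c *: y).
Proof. by congr pair; rewrite /= csscalerAr. Qed.

Let le_norm1 (x : A) : `|x.1| <= `|x|.
Proof. by rewrite prod_normE comparable_le_max ?lexx ?real_comparable. Qed.

Let le_norm2 (x : A) : `|x.2| <= `|x|.
Proof.
by rewrite prod_normE comparable_le_max ?lexx ?orbT ?real_comparable.
Qed.

Let prod_normM (x y : A) : `|prod_mul x y| <= `|x| * `|y|.
Proof.
rewrite [leLHS]prod_normE num_ge_max /=.
by rewrite !(le_trans (csnormM _ _))// ler_pM// ?le_norm1 ?le_norm2.
Qed.

Let prod_starK : involutive prod_star.
Proof. by case=> a b; rewrite /prod_star /= !starK. Qed.

Let prod_star_antilinear (c : R[i]) (x y : A) :
  prod_star (c *: x + y) = c^* *: prod_star x + prod_star y.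
Proof. by congr pair; rewrite /= star_antilinear. Qed.

Let prod_starM (x y : A) :
  prod_star (prod_mul x y) = prod_mul (prod_star y) (prod_star x).
Proof. by congr pair; rewrite /= csstarM. Qed.

Let prod_norm_star (x : A) : `|prod_mul (prod_star x) x| = `|x| ^+ 2.
Proof.
rewrite !prod_normE /= !csnorm_star.
have : `|x.1| >=< `|x.2| by rewrite real_comparable.
case/comparable_leP => h.
- by rewrite max_r// ler_pXn2r// nnegrE.
- by rewrite max_l// ler_pXn2r// ?nnegrE// ltW.
Qed.

HB.instance Definition _ := isCStarAlgebra.Build R A
  prod_mulA prod_mul1l prod_mul1r prod_mulDl prod_mulDr
  prod_scalerAl prod_scalerAr prod_normM prod_starK prod_star_antilinear
  prod_starM prod_norm_star.

End DirectSum.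

Record unital_cstar_subalgebra (R : realType) (A : cstarAlgType R)
    (B : set A) : Prop := {
  subalg_closed : closed B ;
  subalg1 : B 1 ;
  subalg_linear : forall (c : R[i]) (x y : A), B x -> B y -> B (c *: x + y) ;
  subalgM : forall x y : A, B x -> B y -> B (x * y) ;
  subalg_star : forall x : A, B x -> B (star x)
}.

Lemma unital_cstar_subalgebraX (R : realType) (A1 A2 : cstarAlgType R)
    (B1 : set A1) (B2 : set A2) :
  unital_cstar_subalgebra B1 -> unital_cstar_subalgebra B2 ->
  unital_cstar_subalgebra (B1 `*` B2).
Proof.
move=> h1 h2; split.
- have -> : B1 `*` B2 = fst @^-1` B1 `&` snd @^-1` B2 by [].
  apply: closedI.
    by apply: closed_comp (subalg_closed h1) => x _; exact: cvg_fst.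
  by apply: closed_comp (subalg_closed h2) => x _; exact: cvg_snd.
- by split; [exact: (subalg1 h1)|exact: (subalg1 h2)].
- move=> c x y [x1 x2] [y1 y2].
  by split; [exact: (subalg_linear h1)|exact: (subalg_linear h2)].
- move=> x y [x1 x2] [y1 y2].
  by split; [exact: (subalgM h1)|exact: (subalgM h2)].
- move=> x [x1 x2].
  by split; [exact: (subalg_star h1)|exact: (subalg_star h2)].
Qed.

Record star_rep (R : realType) (T : cstarAlgType R) (H : hilbertType R)
    (pi : T -> H -> H) : Prop := {
  rep_linear : forall t, linear (pi t) ;
  rep_continuous : forall t, continuous (pi t) ;
  rep_linearl : forall (c : R[i]) (s t : T) (xi : H),
    pi (c *: s + t) xi = c *: pi s xi + pi t xi ;
  repM : forall (s t : T) (xi : H), pi (s * t) xi = pi s (pi t xi) ;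
  rep_star : forall (t : T) (xi eta : H),
    inner (pi t xi) eta = inner xi (pi (star t) eta)
}.

Definition nondegenerate (R : realType) (T : cstarAlgType R)
    (H : hilbertType R) (pi : T -> H -> H) : Prop :=
  dense [set xi : H | exists s : seq (T * H),
                        xi = \sum_(p <- s) pi p.1 p.2].

(* *-representations of the algebraic tensor product of A and B, given by
   their values rho a b on elementary tensors. *)
Record alg_tensor_rep (R : realType) (A B : cstarAlgType R)
    (H : hilbertType R) (rho : A -> B -> H -> H) : Prop := {
  tensor_rep_linear : forall a b, linear (rho a b) ;
  tensor_rep_continuous : forall a b, continuous (rho a b) ;
  tensor_rep_linearl : forall (c : R[i]) (a a' : A) (b : B) (xi : H),
    rho (c *: a + a') b xi = c *: rho a b xi + rho a' b xi ;
  tensor_rep_linearr : forall (c : R[i]) (a : A) (b b' : B) (xi : H),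
    rho a (c *: b + b') xi = c *: rho a b xi + rho a b' xi ;
  tensor_repM : forall (a a' : A) (b b' : B) (xi : H),
    rho (a * a') (b * b') xi = rho a b (rho a' b' xi) ;
  tensor_rep_star : forall (a : A) (b : B) (xi eta : H),
    inner (rho a b xi) eta = inner xi (rho (star a) (star b) eta)
}.

(* c bounds the maximal C*-norm of the formal sum of elementary tensors s. *)
Definition max_norm_le (R : realType) (A B : cstarAlgType R)
    (s : seq (A * B)) (c : R) : Prop :=
  forall (H : hilbertType R) (rho : A -> B -> H -> H),
    alg_tensor_rep rho -> forall xi : H,
    `|\sum_(p <- s) rho p.1 p.2 xi| <= c%:C * `|xi|.

(* T, with (a, b) |-> tens a b, is the maximal tensor product of A and B: the
   completion of the algebraic tensor product for the maximal C*-norm, the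
   supremum of the norms of the images under all *-representations. *)
Record max_tensor_product (R : realType) (A B T : cstarAlgType R)
    (tens : A -> B -> T) : Prop := {
  tens_linearl : forall (c : R[i]) (a a' : A) (b : B),
    tens (c *: a + a') b = c *: tens a b + tens a' b ;
  tens_linearr : forall (c : R[i]) (a : A) (b b' : B),
    tens a (c *: b + b') = c *: tens a b + tens a b' ;
  tensM : forall (a a' : A) (b b' : B),
    tens (a * a') (b * b') = tens a b * tens a' b' ;
  tens_star : forall (a : A) (b : B),
    star (tens a b) = tens (star a) (star b) ;
  tens_dense : dense [set t : T | exists s : seq (A * B),
                                    t = \sum_(p <- s) tens p.1 p.2] ;
  tens_norm : forall (s : seq (A * B)) (c : R), 0 <= c ->
    `|\sum_(p <- s) tens p.1 p.2| <= c%:C <-> max_norm_le s c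
}.

(* Unital Hilbert bimodules. The maximal tensor product is unique up to
   isomorphism, so bimod_rep does not depend on the choice of T. *)
Record hilbertBimodule (R : realType) (A : cstarAlgType R) := HilbertBimodule {
  bimod_space :> hilbertType R ;
  lact : A -> bimod_space -> bimod_space ;
  ract : bimod_space -> A -> bimod_space ;
  lact1 : forall xi, lact 1 xi = xi ;
  ract1 : forall xi, ract xi 1 = xi ;
  lact_ractC : forall a b xi, lact a (ract xi b) = ract (lact a xi) b ;
  bimod_rep : exists (T : cstarAlgType R) (tens : A -> A^c -> T)
                     (pi : T -> bimod_space -> bimod_space),
    [/\ max_tensor_product tens, star_rep pi, nondegenerate pi
      & forall (a b : A) xi, pi (tens a b) xi = ract (lact a xi) b]
}.

Definition central_vectors (R : realType) (A : cstarAlgType R) (B : set A)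
    (H : hilbertBimodule A) : set H :=
  [set xi | forall b, B b -> lact b xi = ract xi b].
Arguments central_vectors {R A} B H.

(* The orthogonal projection of xi onto the set K; for a closed subspace K the
   defining set is a singleton, and the default value 0 is never used. *)
Definition orth_proj (R : realType) (H : hilbertType R) (K : set H)
    (xi : H) : H :=
  xget 0 [set eta | K eta /\ forall zeta, K zeta -> inner (xi - eta) zeta = 0].

Definition almost_central_unit (R : realType) (A : cstarAlgType R)
    (H : hilbertBimodule A) (Q : set A) (beta : R) : set H :=
  [set xi | `|xi| = 1 /\
            forall x, Q x -> `|lact x xi - ract xi x| < beta%:C].
Arguments almost_central_unit {R A} H Q beta.

Definition property_T (R : realType) (A : cstarAlgType R) (B : set A) : Prop :=
  exists (F : set A) (epsilon : R),
    [/\ finite_set F, F !=set0, 0 < epsilon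
      & forall H : hilbertBimodule A,
          almost_central_unit H F epsilon !=set0 ->
          central_vectors B H <> [set 0]].

Definition strong_property_T (R : realType) (A : cstarAlgType R)
    (B : set A) : Prop :=
  forall alpha : R, 0 < alpha ->
  exists (Q : set A) (beta : R),
    [/\ finite_set Q, Q !=set0, 0 < beta
      & forall (H : hilbertBimodule A) (xi : H),
          almost_central_unit H Q beta xi ->
          `|xi - orth_proj (central_vectors B H) xi| < alpha%:C].

(* Main.v *)
(* Let e1 = (1, 0) and e2 = (0, 1). In a bimodule H over A1 + A2, each e_i H e_i
   is a bimodule over A_i: if T is the maximal tensor product of A and its
   opposite, and p is the image of e_i (x) e_i in T, then the corner p T p is the
   maximal tensor product of A_i and its opposite, and it acts on e_i H e_i.
   If xi almost commutes with e1, then xi is close to e1 xi e1 + e2 xi e2, and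
   property (T) of (A_i, B_i) applies to those normalized terms e_i xi e_i which
   are not too small. Central vectors of e_i H e_i are central in H. *)
From HB Require Import structures.
Require Import Defs.
From mathcomp Require Import all_boot all_order all_algebra.
From mathcomp Require Import all_classical all_reals all_analysis.
From mathcomp Require Import complex ring lra.

Set Implicit Arguments.
Unset Strict Implicit.
Unset Printing Implicit Defensive.

Import Order.TTheory GRing.Theory Num.Theory.
Import numFieldNormedType.Exports.

Local Open Scope classical_set_scope.
Local Open Scope ring_scope.
Local Open Scope complex_scope.

(** * Fixed spaces of continuous linear projections *)

(** A [hilbertBimodule] over a summand must exhibit a maximal tensor product of that summand with
    its opposite, and a representation of it; both are cut out of those that [H] carries. The corner
    of [T] has the right norm because *-representations of the two algebraic tensor products pull
    back to each other along the inclusion and the projection of the summand. Its elementary tensors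
    have dense span because compression by [p] is continuous and sends elementary tensors to
    elementary tensors of the summand. For strong property (T), [orth_proj] is a choice from a set,
    so its defining property rests on the Hilbert projection theorem. Since the projection is then
    the closest central vector, it is enough to exhibit some central vector near [xi], and the sum
    of the approximations found in the two corners is one. *)

Record linProj (K : numFieldType) (V : normedModType K) := LinProj {
  linproj :> V -> V ;
  linproj_linear : linear linproj ;
  linproj_continuous : continuous linproj ;
  linproj_id : forall x, linproj (linproj x) = linproj x
}.

Section FixedPoints.
Variables (K : numFieldType) (V : completeNormedModType K) (P : linProj V).

HB.instance Definition _ :=
  GRing.isLinear.Build K V V *:%R P (@linproj_linear _ _ P).

Definition fixed_pred : {pred V} := [pred x | P x == x].

Lemma fixed_submod_closed : submod_closed fixed_pred.
Proof.
split=> [|c x y]; rewrite !inE; first by rewrite linear0.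
by move=> /eqP Px /eqP Py; rewrite linproj_linear Px Py.
Qed.

HB.instance Definition _ :=
  GRing.isSubmodClosed.Build K V fixed_pred fixed_submod_closed.

(** Serves twice: for [e H e] in a bimodule and for [p T p] in a C*-algebra. Presenting the subspace
    as the range of a continuous projection supplies the retraction [fixproj], through which
    continuity and completeness are transported. *)
Record fixedPoints := FixedPoints {
  fixval : V ;
  _ : fixval \in fixed_pred
}.

HB.instance Definition _ := [isSub for fixval].
HB.instance Definition _ := [Choice of fixedPoints by <:].
HB.instance Definition _ := [SubChoice_isSubLmodule of fixedPoints by <:].

Lemma fixvalP (x : fixedPoints) : P (fixval x) = fixval x.
Proof. by case: x => x /= /eqP. Qed.

Definition fixproj (x : V) : fixedPoints.
Proof. by exists (P x); rewrite inE linproj_id. Defined.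

Lemma fixval_inj : injective fixval.
Proof. exact: val_inj. Qed.

Lemma fixprojE x : fixval (fixproj x) = P x.
Proof. by []. Qed.

Lemma fixprojK : cancel fixval fixproj.
Proof. by move=> x; apply/val_inj; exact: fixvalP. Qed.

Lemma fixval_linear : linear fixval.
Proof. by move=> c x y; rewrite -[LHS]/(val _) linearP. Qed.

Lemma fixvalB : {morph fixval : x y / x - y}.
Proof. exact: zmod_morphism_linear fixval_linear. Qed.

Lemma fixvalZ : scalable fixval.
Proof. exact: scalable_linear fixval_linear. Qed.

Lemma fixproj_linear : linear fixproj.
Proof.
by move=> c x y; apply/fixval_inj; rewrite fixval_linear; exact: linproj_linear.
Qed.

Let norm (x : fixedPoints) : K := `|fixval x|.

Let norm_triangle x y : norm (x + y) <= norm x + norm y.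
Proof. exact: ler_normD. Qed.

Let normZ (l : K) x : norm (l *: x) = `|l| * norm x.
Proof. by rewrite /norm -normrZ. Qed.

Let norm_eq0 x : norm x = 0 -> x = 0.
Proof. by move=> /normr0_eq0 x0; exact: val_inj. Qed.

HB.instance Definition _ :=
  Lmodule_isNormed.Build K fixedPoints norm_triangle normZ norm_eq0.

Lemma norm_fixval (x : fixedPoints) : `|fixval x| = `|x|.
Proof. by []. Qed.

Lemma fixval_continuous : continuous fixval.
Proof.
move=> x; apply/(@cvgrPdist_lt _ _ _ _ (nbhs_filter x)) => e e0.
have := nbhsx_ballx x e e0; rewrite -ball_normE; apply: filterS => y /=.
by rewrite -norm_fixval -[fixval (_ - _)]/(val _) raddfB.
Qed.

Lemma fixproj_continuous : continuous fixproj.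
Proof.
move=> x; apply/cvgrPdist_lt => e e0.
have /cvgrPdist_lt/(_ e e0) := @linproj_continuous _ _ P x.
apply: filterS => y.
by rewrite -norm_fixval -[fixval (_ - _)]/(val _) raddfB.
Qed.

Lemma fixedPoints_complete (F : set_system fixedPoints) :
  ProperFilter F -> cauchy F -> cvg F.
Proof.
move=> FF cF.
have cF' : cauchy (fixval @ F).
  apply/cauchy_ballP => e e0; have /cauchy_ballP/(_ e e0) := cF.
  case=> -[A B] /= [FA FB] AB; exists (fixval @` A, fixval @` B) => /=.
    by split; [apply: filterS FA|apply: filterS FB] => x ?; exists x.
  case=> _ _ /= [[x Ax <-] [y By <-]]; have := AB (x, y) (conj Ax By).
  by rewrite -!ball_normE /= -norm_fixval -[fixval (_ - _)]/(val _) raddfB.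
have cv := cauchy_cvg _ cF'.
(* [fixproj] is continuous and [fixproj \o fixval] is the identity, so convergence of [fixval @ F]
   in [V] pushes forward to convergence of [F]. *)
apply/cvg_ex; exists (fixproj (lim (fixval @ F))).
move=> A /(fixproj_continuous (x := _))/cv.
by congr F; apply/funext => x; rewrite /= fixprojK.
Qed.

HB.instance Definition _ :=
  Uniform_isComplete.Build fixedPoints fixedPoints_complete.

End FixedPoints.

Section FixedHilbert.
Variables (R : realType) (H : hilbertType R) (P : linProj H).
Local Notation S := (fixedPoints P).

Let finner (x y : S) : R[i] := inner (fixval x) (fixval y).

Let finner_linearl (c : R[i]) (x y z : S) :
  finner (c *: x + y) z = c * finner x z + finner y z.
Proof. by rewrite /finner fixval_linear inner_linearl. Qed.

Let finner_conj (x y : S) : finner y x = (finner x y)^*.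
Proof. exact: inner_conj. Qed.

Let finner_norm (x : S) : finner x x = `|x| ^+ 2.
Proof. exact: inner_norm. Qed.

HB.instance Definition _ :=
  isHilbert.Build R S finner_linearl finner_conj finner_norm.

Lemma inner_fixval (x y : S) : inner (fixval x) (fixval y) = inner x y.
Proof. by []. Qed.

End FixedHilbert.

(** * Corners of C*-algebras *)

Section CStarTheory.
Variables (R : realType) (T : cstarAlgType R).
Implicit Types x y : T.

Lemma scalerMl (c : R[i]) x y : (c *: x) * y = c *: (x * y).
Proof. by rewrite -[RHS]/(c *: csmul x y) csscalerAl. Qed.

Lemma scalerMr (c : R[i]) x y : x * (c *: y) = c *: (x * y).
Proof. by rewrite -[RHS]/(c *: csmul x y) csscalerAr. Qed.

Lemma starM x y : star (x * y) = star y * star x.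
Proof. exact: csstarM. Qed.

Lemma star1 : star (1 : T) = 1.
Proof. by rewrite -[LHS]mul1r -{1}[1]starK -starM mul1r starK. Qed.

Lemma mul_continuousl x : continuous (fun y => x * y).
Proof.
move=> y; apply/cvgrPdist_lt => e e0.
have d0 : 0 < e / (`|x| + 1) by rewrite divr_gt0// ltr_wpDl.
have := nbhsx_ballx y _ d0; rewrite -ball_normE; apply: filterS => z /=.
rewrite ltr_pdivlMr ?ltr_wpDl// -mulrBr => h.
apply: le_lt_trans h; apply: le_trans (csnormM _ _) _.
by rewrite mulrC ler_wpM2l// lerDl.
Qed.

Lemma mul_continuousr x : continuous (fun y => y * x).
Proof.
move=> y; apply/cvgrPdist_lt => e e0.
have d0 : 0 < e / (`|x| + 1) by rewrite divr_gt0// ltr_wpDl.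
have := nbhsx_ballx y _ d0; rewrite -ball_normE; apply: filterS => z /=.
rewrite ltr_pdivlMr ?ltr_wpDl// -mulrBl => h.
apply: le_lt_trans h; apply: le_trans (csnormM _ _) _.
by rewrite ler_wpM2l// lerDl.
Qed.

End CStarTheory.

Record saproj (R : realType) (T : cstarAlgType R) := SAProj {
  saprojval : T ;
  saprojM : saprojval * saprojval = saprojval ;
  saproj_star : star saprojval = saprojval
}.

Section Corner.
Variables (R : realType) (T : cstarAlgType R) (q : saproj T).
Local Notation p := (saprojval q).

Definition corner_fun (t : T) : T := p * t * p.

Lemma corner_linear : linear corner_fun.
Proof.
by move=> c x y; rewrite /corner_fun mulrDr mulrDl scalerMr scalerMl.
Qed.

Lemma corner_continuous : continuous corner_fun.
Proof.
move=> x; apply: (@continuous_comp _ _ _ ( *%R p) ( *%R^~ p)).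
- exact: mul_continuousl.
- exact: mul_continuousr.
Qed.

Lemma corner_id t : corner_fun (corner_fun t) = corner_fun t.
Proof. by rewrite /corner_fun !mulrA saprojM -!mulrA saprojM. Qed.

Definition corner_proj : linProj T :=
  LinProj corner_linear corner_continuous corner_id.

(** An alias, so that the C*-structure attaches to corners rather than to all fixed spaces. *)
Definition corner : Type := fixedPoints corner_proj.

HB.instance Definition _ := CompleteNormedModule.on corner.

Definition cornerval (x : corner) : T := fixval x.
Definition corner_in (t : T) : corner := fixproj corner_proj t.

Lemma cornervalP x : p * cornerval x * p = cornerval x.
Proof. exact: (fixvalP x). Qed.

Lemma cornerval_inj : injective cornerval.
Proof. by move=> x y e; exact: val_inj. Qed.

Lemma corner_inE t : cornerval (corner_in t) = p * t * p.
Proof. by []. Qed.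

Lemma cornervalK : cancel cornerval corner_in.
Proof. exact: fixprojK. Qed.

Lemma cornerMl x : p * cornerval x = cornerval x.
Proof. by rewrite -cornervalP !mulrA saprojM. Qed.

Lemma cornerMr x : cornerval x * p = cornerval x.
Proof. by rewrite -cornervalP -!mulrA saprojM. Qed.

Let cone : corner := corner_in 1.
Let cmul (x y : corner) : corner := corner_in (cornerval x * cornerval y).
Let cstar (x : corner) : corner := corner_in (star (cornerval x)).

Let coneE : cornerval cone = p.
Proof. by rewrite corner_inE mulr1 saprojM. Qed.

Let cmulE x y : cornerval (cmul x y) = cornerval x * cornerval y.
Proof. by rewrite corner_inE mulrA cornerMl -mulrA cornerMr. Qed.

Let cstarE x : cornerval (cstar x) = star (cornerval x).
Proof.
rewrite corner_inE -[in LHS](saproj_star q) -!starM.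
by rewrite cornerMr cornerMl.
Qed.

Let cornerE := (coneE, cmulE, cstarE).

Let cvalP c x y : cornerval (c *: x + y) = c *: cornerval x + cornerval y.
Proof. exact: fixval_linear. Qed.

Let cvalD x y : cornerval (x + y) = cornerval x + cornerval y.
Proof. by have := cvalP 1 x y; rewrite !scale1r. Qed.

Let cvalZ c x : cornerval (c *: x) = c *: cornerval x.
Proof. exact: (linearZ_LR (val : {linear _ -> _})). Qed.

Let cmulA : associative cmul.
Proof. by move=> x y z; apply/cornerval_inj; rewrite !cornerE mulrA. Qed.

Let cmul1l : left_id cone cmul.
Proof. by move=> x; apply/cornerval_inj; rewrite !cornerE cornerMl. Qed.

Let cmul1r : right_id cone cmul.
Proof. by move=> x; apply/cornerval_inj; rewrite !cornerE cornerMr. Qed.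

Let cmulDl : left_distributive cmul +%R.
Proof.
by move=> x y z; apply/cornerval_inj; rewrite !(cornerE, cvalD) mulrDl.
Qed.

Let cmulDr : right_distributive cmul +%R.
Proof.
by move=> x y z; apply/cornerval_inj; rewrite !(cornerE, cvalD) mulrDr.
Qed.

Let cscalerAl (c : R[i]) x y : c *: cmul x y = cmul (c *: x) y.
Proof. by apply/cornerval_inj; rewrite !(cornerE, cvalZ) scalerMl. Qed.

Let cscalerAr (c : R[i]) x y : c *: cmul x y = cmul x (c *: y).
Proof. by apply/cornerval_inj; rewrite !(cornerE, cvalZ) scalerMr. Qed.

Let cnormE (x : corner) : `|x| = `|cornerval x|.
Proof. by []. Qed.

Let cnormM (x y : corner) : `|cmul x y| <= `|x| * `|y|.
Proof. by rewrite !cnormE cmulE csnormM. Qed.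

Let cstarK : involutive cstar.
Proof. by move=> x; apply/cornerval_inj; rewrite !cornerE starK. Qed.

Let cstar_antilinear (c : R[i]) x y :
  cstar (c *: x + y) = c^* *: cstar x + cstar y.
Proof.
by apply/cornerval_inj; rewrite !(cornerE, cvalP) star_antilinear.
Qed.

Let cstarM x y : cstar (cmul x y) = cmul (cstar y) (cstar x).
Proof. by apply/cornerval_inj; rewrite !cornerE starM. Qed.

Let cnorm_star (x : corner) : `|cmul (cstar x) x| = `|x| ^+ 2.
Proof. by rewrite !cnormE !cornerE -csnorm_star. Qed.

HB.instance Definition _ := isCStarAlgebra.Build R corner
  cmulA cmul1l cmul1r cmulDl cmulDr cscalerAl cscalerAr cnormM cstarK
  cstar_antilinear cstarM cnorm_star.

Definition cornerAlg : cstarAlgType R := corner.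

Lemma cornerval_linear : linear (cornerval : cornerAlg -> T).
Proof. exact: cvalP. Qed.

Lemma cornerval1 : cornerval (1 : cornerAlg) = p.
Proof. exact: coneE. Qed.

Lemma cornervalM (x y : cornerAlg) :
  cornerval (x * y) = cornerval x * cornerval y.
Proof. exact: cmulE. Qed.

Lemma cornerval_star (x : cornerAlg) :
  cornerval (star x) = star (cornerval x).
Proof. exact: cstarE. Qed.

Lemma norm_cornerval (x : cornerAlg) : `|cornerval x| = `|x|.
Proof. by []. Qed.

Lemma corner_in_continuous : continuous (corner_in : T -> cornerAlg).
Proof. exact: fixproj_continuous. Qed.

End Corner.

(** * Compression of Hilbert bimodules to a direct summand *)

Section BimoduleTheory.
Variables (R : realType) (A : cstarAlgType R) (H : hilbertBimodule A).
Implicit Types (a b : A) (xi eta : H).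

(** The record postulates no linearity. Since [1] acts trivially on the right, [lact a] is
    [pi (tens a 1)], and the properties of the left action are read off from [pi]; likewise the
    right action of [b] is [pi (tens 1 b)]. *)
Lemma lact_linear a : linear (lact a : H -> H).
Proof.
have [T [tens [pi [_ hpi _ piE]]]] := bimod_rep H.
have lactE xi : lact a xi = pi (tens a (1 : A)) xi by rewrite piE ract1.
by move=> c xi eta; rewrite !lactE rep_linear.
Qed.

Lemma ract_linear b : linear ((fun xi => ract xi b) : H -> H).
Proof.
have [T [tens [pi [_ hpi _ piE]]]] := bimod_rep H.
have ractE xi : ract xi b = pi (tens 1 b) xi by rewrite piE lact1.
by move=> c xi eta; rewrite !ractE rep_linear.
Qed.

Lemma lact_continuous a : continuous (lact a : H -> H).
Proof.
have [T [tens [pi [_ hpi _ piE]]]] := bimod_rep H.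
have -> : lact a = pi (tens a (1 : A)) by apply/funext => xi; rewrite piE ract1.
exact: rep_continuous.
Qed.

Lemma ract_continuous b : continuous ((fun xi => ract xi b) : H -> H).
Proof.
have [T [tens [pi [_ hpi _ piE]]]] := bimod_rep H.
have -> : (fun xi => ract xi b) = pi (tens 1 b).
  by apply/funext => xi; rewrite piE lact1.
exact: rep_continuous.
Qed.

Lemma lact_linearl xi : linear ((fun a => lact a xi) : A -> H).
Proof.
have [T [tens [pi [hT hpi _ piE]]]] := bimod_rep H.
have lactE a : lact a xi = pi (tens a (1 : A)) xi by rewrite piE ract1.
by move=> c a b; rewrite !lactE (tens_linearl hT) (rep_linearl hpi).
Qed.

Lemma ract_linearr xi : linear (ract xi : A -> H).
Proof.
have [T [tens [pi [hT hpi _ piE]]]] := bimod_rep H.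
have ractE b : ract xi b = pi (tens 1 b) xi by rewrite piE lact1.
by move=> c a b; rewrite !ractE (tens_linearr hT) (rep_linearl hpi).
Qed.

Lemma lactM a b xi : lact (a * b) xi = lact a (lact b xi).
Proof.
have [T [tens [pi [hT hpi _ piE]]]] := bimod_rep H.
have lactE d eta : lact d eta = pi (tens d (1 : A)) eta by rewrite piE ract1.
rewrite !lactE -(repM hpi); congr (pi _ _).
by rewrite -(tensM hT); congr (tens _ _); exact: (esym (csmul1r (1 : A))).
Qed.

Lemma ractM a b xi : ract xi (a * b) = ract (ract xi a) b.
Proof.
have [T [tens [pi [hT hpi _ piE]]]] := bimod_rep H.
have ractE (d : A) eta : ract eta d = pi (tens 1 d) eta by rewrite piE lact1.
rewrite !ractE -(repM hpi); congr (pi _ _).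
by rewrite -(tensM hT); congr (tens _ _); rewrite mulr1.
Qed.

Lemma inner_lact a xi eta :
  inner (lact a xi) eta = inner xi (lact (star a) eta).
Proof.
have [T [tens [pi [hT hpi _ piE]]]] := bimod_rep H.
have lactE d zeta : lact d zeta = pi (tens d (1 : A)) zeta.
  by rewrite piE ract1.
rewrite !lactE (rep_star hpi) (tens_star hT); congr (inner _ (pi (tens _ _) _)).
exact: (star1 A).
Qed.

Lemma inner_ract b xi eta :
  inner (ract xi b) eta = inner xi (ract eta (star b)).
Proof.
have [T [tens [pi [hT hpi _ piE]]]] := bimod_rep H.
have ractE (d : A) zeta : ract zeta d = pi (tens 1 d) zeta by rewrite piE lact1.
by rewrite !ractE (rep_star hpi) (tens_star hT) star1.
Qed.

Lemma lactB a : {morph (lact a : H -> H) : xi eta / xi - eta}.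
Proof. exact: zmod_morphism_linear (lact_linear a). Qed.

Lemma lactZ a : scalable (lact a : H -> H).
Proof. exact: scalable_linear (lact_linear a). Qed.

Lemma ractB b : {morph (fun xi : H => ract xi b) : xi eta / xi - eta}.
Proof. exact: zmod_morphism_linear (ract_linear b). Qed.

Lemma ractZ b : scalable (fun xi : H => ract xi b).
Proof. exact: scalable_linear (ract_linear b). Qed.

End BimoduleTheory.

(** Abstract, so that both factors of the direct sum are treated by one argument. The last two laws
    identify [summand_in] after [summand_out] with multiplication by [summand_in 1] on either side,
    which makes this projection central. *)
Record summand (R : realType) (A C : cstarAlgType R) := Summand {
  summand_in : C -> A ;
  summand_out : A -> C ;
  summand_in_linear : linear summand_in ;
  summand_out_linear : linear summand_out ;
  summand_inM : forall x y, summand_in (x * y) = summand_in x * summand_in y ;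
  summand_outM : forall a b,
    summand_out (a * b) = summand_out a * summand_out b ;
  summand_in_star : forall x, summand_in (star x) = star (summand_in x) ;
  summand_out_star : forall a, summand_out (star a) = star (summand_out a) ;
  summand_inK : cancel summand_in summand_out ;
  summand_outKl : forall a, summand_in (summand_out a) = summand_in 1 * a ;
  summand_outKr : forall a, summand_in (summand_out a) = a * summand_in 1
}.

(** * The maximal tensor product of a summand with its opposite *)

Section SummandTensor.
Variables (R : realType) (A C : cstarAlgType R) (S : summand A C).
Local Notation iota := (summand_in S).
Local Notation rho := (summand_out S).

Definition summand_one : A := iota 1.
Local Notation e := summand_one.

Lemma summand_oneM : e * e = e.
Proof. by rewrite -summand_inM mulr1. Qed.

Lemma summand_one_star : star e = e.
Proof. by rewrite -summand_in_star star1. Qed.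

Lemma summand_oneMl a : e * iota a = iota a.
Proof. by rewrite -summand_inM mul1r. Qed.

Lemma summand_oneMr a : iota a * e = iota a.
Proof. by rewrite -summand_inM mulr1. Qed.

Lemma summand_oneC a : a * e = e * a.
Proof. by rewrite -summand_outKr summand_outKl. Qed.

(* Representations of the algebraic tensor product may be degenerate, so they
   can be composed with the inclusion and with the projection of the summand. *)
Lemma max_norm_le_summand (s : seq (C * C^c)) (c : R) :
  max_norm_le (A := A) (B := A^c) [seq (iota p.1, iota p.2) | p <- s] c <->
  max_norm_le s c.
Proof.
split=> hs H r hr xi.
  have hr' : alg_tensor_rep (A := A) (B := A^c)
      (fun a b => r (rho a) (rho (b : A) : C^c)).
    split=> [a b|a b|k a a' b eta|k a b b' eta|a a' b b' eta|a b eta zeta].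
    - exact: (tensor_rep_linear hr).
    - exact: (tensor_rep_continuous hr).
    - by rewrite summand_out_linear (tensor_rep_linearl hr).
    - by rewrite -(tensor_rep_linearr hr); congr (r _ _ _);
        exact: (summand_out_linear S k (b : A) b').
    - by rewrite -(tensor_repM hr) summand_outM; congr (r _ _ _);
        exact: (summand_outM S (b' : A) b).
    - by rewrite (tensor_rep_star hr) summand_out_star;
        congr (inner _ (r _ _ _)); exact: esym (summand_out_star S (b : A)).
  have := hs H _ hr' xi; rewrite big_map /=.
  by under eq_bigr do rewrite !summand_inK.
rewrite big_map /=.
suff hr' : alg_tensor_rep (fun a (b : C^c) => r (iota a) (iota (b : C) : A^c)).
  exact: hs hr' xi.
split=> [a b|a b|k a a' b eta|k a b b' eta|a a' b b' eta|a b eta zeta].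
- exact: (tensor_rep_linear hr).
- exact: (tensor_rep_continuous hr).
- by rewrite summand_in_linear (tensor_rep_linearl hr).
- by rewrite -(tensor_rep_linearr hr); congr (r _ _ _);
    exact: (summand_in_linear S k (b : C) b').
- by rewrite -(tensor_repM hr) summand_inM; congr (r _ _ _);
    exact: (summand_inM S (b' : C) b).
- by rewrite (tensor_rep_star hr) summand_in_star;
    congr (inner _ (r _ _ _)); exact: esym (summand_in_star S (b : C)).
Qed.

Variables (T : cstarAlgType R) (tens : A -> A^c -> T).
Hypothesis hT : max_tensor_product tens.

(** The second legs multiply in reverse order; writing this with the product of [A] lets the ring
    identities of [A] be used in both legs. *)
Lemma tensM_op (a a' b b' : A) :
  tens (a * a') (b' * b) = tens a b * tens a' b'.
Proof. exact: tensM hT a a' b b'. Qed.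

Lemma tens_oneM : tens e e * tens e e = tens e e.
Proof. by rewrite -tensM_op summand_oneM. Qed.

Lemma tens_one_star : star (tens e e) = tens e e.
Proof.
rewrite (tens_star hT) summand_one_star.
by congr (tens _ _); exact: summand_one_star.
Qed.

Definition tens_one := SAProj tens_oneM tens_one_star.

Definition summand_tens (x : C) (y : C^c) : cornerAlg tens_one :=
  corner_in tens_one (tens (iota x) (iota y)).

Lemma summand_tensE x y :
  cornerval (summand_tens x y) = tens (iota x) (iota y).
Proof.
by rewrite corner_inE /= -!tensM_op !(summand_oneMl, summand_oneMr).
Qed.

(** Compression by [tens e e] multiplies each leg by [e] on both sides, which for the central
    idempotent [e] amounts to [iota] after [rho]. Density of the elementary tensors in the corner
    depends on this. *)
Lemma summand_tens_out (a b : A) :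
  summand_tens (rho a) (rho b) = corner_in tens_one (tens a b).
Proof.
apply/cornerval_inj; rewrite summand_tensE corner_inE /= -!tensM_op.
rewrite summand_outKl summand_outKr; congr (tens _ _).
  by rewrite (summand_oneC (_ * a)) mulrA summand_oneM.
by rewrite -(summand_oneC (b * e)) -mulrA summand_oneM.
Qed.

Lemma cornerval_sum (I : Type) (s : seq I) (F : I -> cornerAlg tens_one) :
  cornerval (\sum_(i <- s) F i) = \sum_(i <- s) cornerval (F i).
Proof.
elim/big_rec2: _ => [|i y x _ <-].
  exact: (raddf0 (val : {additive _ -> _})).
exact: (raddfD (val : {additive _ -> _})).
Qed.

Lemma summand_max_tensor_product : max_tensor_product summand_tens.
Proof.
split.
- move=> c a a' b; apply/cornerval_inj.
  by rewrite cornerval_linear !summand_tensE summand_in_linear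
    (tens_linearl hT).
- move=> c a b b'; apply/cornerval_inj.
  rewrite cornerval_linear !summand_tensE -(tens_linearr hT).
  by congr (tens _ _); exact: (summand_in_linear S c (b : C) b').
- move=> a a' b b'; apply/cornerval_inj.
  rewrite cornervalM !summand_tensE -tensM_op summand_inM.
  by congr (tens _ _); exact: (summand_inM S (b' : C) b).
- move=> a b; apply/cornerval_inj.
  rewrite cornerval_star !summand_tensE (tens_star hT) summand_in_star.
  by congr (tens _ _); exact: esym (summand_in_star S (b : C)).
(* An open set of the corner is pulled back to [T] by the continuous compression; a sum of
   elementary tensors found there compresses to a sum of elementary tensors of the summand. *)
- move=> O [t Ot] oO.
  have [||u [Ou [s us]]] := tens_dense hT (O := corner_in tens_one @^-1` O).
  + by exists (cornerval t); rewrite /= cornervalK.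
  + have /continuousP h := @corner_in_continuous _ _ tens_one; exact: h oO.
  exists (corner_in tens_one u); split=> //.
  exists [seq (rho p.1, (rho p.2 : C^c)) | p <- s].
  rewrite big_map us; apply/cornerval_inj; rewrite cornerval_sum corner_inE.
  rewrite mulr_sumr mulr_suml; apply: eq_bigr => p _.
  by rewrite summand_tens_out.
(* The corner carries the norm of [T], which on these sums is the maximal norm over [A];
   [max_norm_le_summand] turns it into the one over [C]. *)
- move=> s c c0; rewrite -norm_cornerval cornerval_sum.
  under eq_bigr do rewrite summand_tensE.
  rewrite -max_norm_le_summand -(tens_norm hT)// big_map.
  by [].
Qed.

End SummandTensor.

(** * The bimodule [e H e] over a summand *)

Section Compression.
Variables (R : realType) (A C : cstarAlgType R) (S : summand A C).
Variable H : hilbertBimodule A.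
Local Notation iota := (summand_in S).
Local Notation e := (summand_one S).

Definition compress_fun (xi : H) : H := ract (lact e xi) e.

Lemma compress_linear : linear compress_fun.
Proof. by move=> c xi eta; rewrite /compress_fun lact_linear ract_linear. Qed.

Lemma compress_continuous : continuous compress_fun.
Proof.
move=> xi.
apply: (@continuous_comp _ _ _ (lact e) (fun eta : H => ract eta e)).
- exact: lact_continuous.
- exact: ract_continuous.
Qed.

Lemma compress_id xi : compress_fun (compress_fun xi) = compress_fun xi.
Proof.
by rewrite /compress_fun lact_ractC -lactM -ractM summand_oneM.
Qed.

Definition compress_proj : linProj H :=
  LinProj compress_linear compress_continuous compress_id.

Local Notation K := (fixedPoints compress_proj).

Lemma compressE xi : compress_proj xi = ract (lact e xi) e.
Proof. by []. Qed.

Lemma lact_compress x xi :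
  lact (iota x) (compress_proj xi) = compress_proj (lact (iota x) xi).
Proof.
by rewrite !compressE lact_ractC -!lactM summand_oneMl summand_oneMr.
Qed.

Lemma ract_compress x xi :
  ract (compress_proj xi) (iota x) = compress_proj (ract xi (iota x)).
Proof.
rewrite !compressE -ractM summand_oneMl lact_ractC -ractM.
by rewrite summand_oneMr.
Qed.

Lemma lact_one_compress xi : lact e (compress_proj xi) = compress_proj xi.
Proof. by rewrite compressE lact_ractC -lactM summand_oneM. Qed.

Lemma ract_one_compress xi : ract (compress_proj xi) e = compress_proj xi.
Proof. by rewrite compressE -ractM summand_oneM. Qed.

Definition compress_lact (x : C) (xi : K) : K :=
  fixproj compress_proj (lact (iota x) (fixval xi)).

Definition compress_ract (xi : K) (x : C) : K :=
  fixproj compress_proj (ract (fixval xi) (iota x)).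

Lemma compress_lactE x xi :
  fixval (compress_lact x xi) = lact (iota x) (fixval xi).
Proof. by rewrite fixprojE -lact_compress fixvalP. Qed.

Lemma compress_ractE x xi :
  fixval (compress_ract xi x) = ract (fixval xi) (iota x).
Proof. by rewrite fixprojE -ract_compress fixvalP. Qed.

Lemma compress_lact1 xi : compress_lact 1 xi = xi.
Proof.
by apply/fixval_inj; rewrite compress_lactE -fixvalP lact_one_compress.
Qed.

Lemma compress_ract1 xi : compress_ract xi 1 = xi.
Proof.
by apply/fixval_inj; rewrite compress_ractE -fixvalP ract_one_compress.
Qed.

Lemma compress_lact_ractC x y xi :
  compress_lact x (compress_ract xi y) = compress_ract (compress_lact x xi) y.
Proof.
apply/fixval_inj.
by rewrite compress_ractE !compress_lactE compress_ractE lact_ractC.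
Qed.

(** [compress_proj] is the action of the projection [p = tens e e], so the operators that [pi]
    assigns to corner elements commute with it and preserve its range. *)
Lemma compress_rep : exists (T : cstarAlgType R) (tens : C -> C^c -> T)
    (pi : T -> K -> K),
  [/\ max_tensor_product tens, star_rep pi, Defs.nondegenerate pi
    & forall (x y : C) xi,
        pi (tens x y) xi = compress_ract (compress_lact x xi) y].
Proof.
have [T [tens [pi [hT hpi _ piE]]]] := bimod_rep H.
pose p := tens_one S hT.
have PE xi : compress_proj xi = pi (saprojval p) xi by rewrite piE.
have piP t xi : pi (cornerval (t : cornerAlg p)) (compress_proj xi) =
    compress_proj (pi (cornerval t) xi).
  by rewrite !PE -!(repM hpi) cornerMl cornerMr.
pose pi' (t : cornerAlg p) (xi : K) : K :=
  fixproj compress_proj (pi (cornerval t) (fixval xi)).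
have pi'E t xi : fixval (pi' t xi) = pi (cornerval t) (fixval xi).
  by rewrite fixprojE -piP fixvalP.
have hpi' : star_rep pi'.
  split=> [t c xi eta|t xi|c s t xi|s t xi|t xi eta].
  - by rewrite /pi' fixval_linear (rep_linear hpi) fixproj_linear.
  - apply: (@continuous_comp _ _ _
      (pi (cornerval t) \o fixval (P := compress_proj))
      (fixproj compress_proj)).
      apply: (@continuous_comp _ _ _ (fixval (P := compress_proj))).
        exact: fixval_continuous.
      exact: (rep_continuous hpi).
    exact: fixproj_continuous.
  - by rewrite /pi' cornerval_linear (rep_linearl hpi) fixproj_linear.
  - by apply/fixval_inj; rewrite !pi'E cornervalM (repM hpi).
  - by rewrite -!inner_fixval !pi'E (rep_star hpi) cornerval_star.
exists (cornerAlg p), (summand_tens S hT), pi'; split=> //.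
- exact: summand_max_tensor_product.
(* The unit of the corner acts as the identity on [K], so every vector is already a sum with one
   term. *)
- move=> O [xi Oxi] _; exists xi; split=> //; exists [:: (1 : cornerAlg p, xi)].
  rewrite big_seq1; apply/fixval_inj.
  by rewrite pi'E cornerval1 -PE fixvalP.
- move=> x y xi; apply/fixval_inj.
  by rewrite pi'E summand_tensE piE compress_ractE compress_lactE.
Qed.

Definition compress : hilbertBimodule C :=
  HilbertBimodule compress_lact1 compress_ract1 compress_lact_ractC
    compress_rep.

Definition compressed (xi : H) : compress := fixproj compress_proj xi.

Lemma fixval_compressed xi : fixval (compressed xi) = compress_proj xi.
Proof. exact: fixprojE. Qed.

End Compression.

(** * Orthogonal projections in Hilbert spaces *)

(** With [a], [c], [n] standing for [|x|^2], [inner x z], [|z|^2], this is the value of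
    [|x + t z|^2] at its minimizing coefficient [t = - (c / n)]. *)
Lemma completion_of_square (F : rcfType) (a c n : F[i]) : 0 < n ->
  a + (- (c / n))^* * c + ((- (c / n))^* * c)^* + `|- (c / n)| ^+ 2 * n =
  a - `|c| ^+ 2 / n.
Proof.
(* Conjugation is hidden behind [k] so that [field] sees conjugates as atoms. *)
move=> n0; pose k : F[i] -> F[i] := fun z => z^*.
have kM : {morph k : x y / x * y} by exact: rmorphM.
have kN : {morph k : x / - x} by exact: rmorphN.
have kV : {morph k : x / x^-1} by exact: fmorphV.
have kn : k n = n by rewrite -(RRe_real (gtr0_real n0)); exact: conjc_real.
have nn0 : n != 0 by rewrite gt_eqF.
have kK : involutive k by exact: conjcK.
rewrite !sqr_normc.
change (a + k (- (c / n)) * c + k (k (- (c / n)) * c) +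
  - (c / n) * k (- (c / n)) * n = a - c * k c / n).
rewrite !(kN, kM, kV) !kn kK.
by field.
Qed.

Section InnerTheory.
Variables (R : realType) (H : hilbertType R).
Implicit Types x y z : H.

Lemma inner0l y : inner 0 y = 0.
Proof.
by have := inner_linearl 1 0 0 y; rewrite scaler0 addr0 mul1r => /esym/eqP;
  rewrite -subr_eq0 addrK => /eqP.
Qed.

Lemma innerDl x y z : inner (x + y) z = inner x z + inner y z.
Proof. by have := inner_linearl 1 x y z; rewrite scale1r mul1r. Qed.

Lemma innerZl c x z : inner (c *: x) z = c * inner x z.
Proof. by have := inner_linearl c x 0 z; rewrite inner0l !addr0. Qed.

Lemma innerDr x y z : inner x (y + z) = inner x y + inner x z.
Proof. by rewrite inner_conj innerDl rmorphD /= -!inner_conj. Qed.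

Lemma innerZr c x z : inner x (c *: z) = c^* * inner x z.
Proof. by rewrite inner_conj innerZl rmorphM /= -!inner_conj. Qed.

Lemma sqr_normD x y :
  `|x + y| ^+ 2 = `|x| ^+ 2 + inner x y + (inner x y)^* + `|y| ^+ 2.
Proof.
by rewrite -!inner_norm innerDl !innerDr [inner y x]inner_conj !addrA.
Qed.

Lemma pythagoras x y : inner x y = 0 ->
  `|x + y| ^+ 2 = `|x| ^+ 2 + `|y| ^+ 2.
Proof. by move=> xy; rewrite sqr_normD xy rmorph0 !addr0. Qed.

Lemma pythagoras_le x y : inner x y = 0 -> `|x| <= `|x + y|.
Proof.
move=> /pythagoras h; rewrite -(@ler_pXn2r _ 2)// ?nnegrE// h.
by rewrite lerDl exprn_ge0.
Qed.

Lemma parallelogram x y :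
  `|x + y| ^+ 2 + `|x - y| ^+ 2 = 2 * `|x| ^+ 2 + 2 * `|y| ^+ 2.
Proof.
rewrite !sqr_normD normrN -scaleN1r innerZr rmorphN rmorph1 mulN1r rmorphN.
by ring.
Qed.

(** At the minimizing coefficient the squared norm drops by [|inner x z|^2 / |z|^2], so this
    quantity must vanish. *)
Lemma min_norm_orthogonal x z :
  (forall c : R[i], `|x| <= `|x + c *: z|) -> inner x z = 0.
Proof.
move=> xmin; have [->|z0] := eqVneq z 0.
  by rewrite inner_conj inner0l rmorph0.
have n0 : `|z| != 0 by rewrite normr_eq0.
have n_gt0 : 0 < `|z| ^+ 2 by rewrite exprn_gt0// lt_def n0 normr_ge0.
have := xmin (- (inner x z / `|z| ^+ 2)).
rewrite -(@ler_pXn2r _ 2)// ?nnegrE// sqr_normD innerZr normrZ exprMn.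
rewrite [leRHS](completion_of_square _ _ n_gt0) lerBrDl gerDr.
rewrite pmulr_lle0 ?invr_gt0// => c0.
have : `|inner x z| ^+ 2 == 0 by rewrite eq_le c0 exprn_ge0.
by rewrite sqrf_eq0 normr_eq0 => /eqP.
Qed.

End InnerTheory.

(** * The Hilbert projection theorem *)

Section HilbertProjection.
Variables (R : realType) (H : hilbertType R) (K : set H).
Hypothesis K0 : K 0.
Hypothesis KP : forall (c : R[i]) x y, K x -> K y -> K (c *: x + y).
Hypothesis cK : closed K.

(** Norms take values in [R[i]]; infima and real arithmetic need them in [R]. *)
Let nr (x : H) : R := complex.Re `|x|.

Let nrE x : `|x| = (nr x)%:C.
Proof. by rewrite RRe_real// ger0_real. Qed.

(* By the parallelogram identity, near-minimizers of the distance to xi form a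
   Cauchy filter on K. *)
Lemma closest_point (xi : H) :
  exists2 eta, K eta & forall zeta, K zeta -> `|xi - eta| <= `|xi - zeta|.
Proof.
pose D := [set nr (xi - k) | k in K].
have D0 : D !=set0 by exists (nr (xi - 0)); exists 0.
have nr_ge0 x : 0 <= nr x by have := normr_ge0 x; rewrite nrE (lecR 0).
have Dlb : has_lbound D by exists 0 => _ [k _ <-].
pose d := inf D.
have dle k : K k -> d <= nr (xi - k).
  by move=> Kk; apply: ge_inf => //; exists k.
have d0 : 0 <= d by apply: lb_le_inf => // _ [k _ <-].
pose near_min (e : R) := [set k | K k /\ nr (xi - k) < d + e].
have near_min0 e : 0 < e -> near_min e !=set0.
  move=> e0; have [_ [k Kk <-] kd] := inf_adherent e0 (conj D0 Dlb).
  by exists k.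
pose F := filter_from [set e : R | 0 < e] near_min.
have FF : ProperFilter F.
  apply: filter_from_proper => //; apply: filter_from_filter.
    by exists 1 => /=.
  move=> e f /= e0 f0; exists (Num.min e f) => /=; first by rewrite lt_min e0.
  by move=> k [Kk]; rewrite -ltrBlDl lt_min !ltrBlDl => /andP[].
(* The midpoint of [a] and [b] lies in [K], hence at distance at least [d] from [xi]; the
   parallelogram identity leaves [4 (d + e)^2 - 4 d^2]. *)
have near_minB e a b : 0 < e -> near_min e a -> near_min e b ->
    nr (a - b) ^+ 2 <= 8 * d * e + 4 * e ^+ 2.
  move=> e0 [Ka ae] [Kb be].
  have Km : K (2^-1 *: a + 2^-1 *: b).
    by apply: KP => //; rewrite -[_ *: b]addr0; exact: KP.
  have := parallelogram (xi - a) (xi - b).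
  have -> : (xi - a) - (xi - b) = - (a - b) by rewrite opprB addrC subrKA opprB.
  have -> : (xi - a) + (xi - b) = 2 *: (xi - (2^-1 *: a + 2^-1 *: b)).
    rewrite scalerBr scalerDr !scalerA divff// !scale1r.
    by rewrite scaler_nat mulr2n opprD addrACA.
  have := dle _ Km; rewrite normrZ normrN normr_nat !nrE.
  move: (nr_ge0 (xi - a)) (nr_ge0 (xi - b)) ae be.
  set u := nr (xi - a); set v := nr (xi - b); set m := nr (xi - _).
  move=> u0 v0 ue ve dm.
  rewrite -!rmorphXn -(rmorph_nat (real_complex R)) -!rmorphM -!rmorphXn.
  rewrite -!rmorphD => /(congr1 (@complex.Re R)) /=.
  have u2 : u ^+ 2 <= (d + e) ^+ 2 by rewrite lerXn2r// ?nnegrE; lra.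
  have v2 : v ^+ 2 <= (d + e) ^+ 2 by rewrite lerXn2r// ?nnegrE; lra.
  have m2 : d ^+ 2 <= m ^+ 2 by rewrite lerXn2r// ?nnegrE; lra.
  by nra.
have cF : cauchy F.
  apply/cauchy_ballP => e e0.
  have eR : (complex.Re e)%:C = e by rewrite RRe_real// gtr0_real.
  pose r := complex.Re e; have r0 : 0 < r by rewrite -ltcR eR.
  (* As [f <= 1], one gets [8 d f + 4 f^2 <= f (8 d + 4) < f (8 d + 5) <= r^2]; taking [5] instead
     of [4] makes the bound strict. *)
  pose f := Num.min 1 (r ^+ 2 / (8 * d + 5)).
  have f0 : 0 < f by rewrite lt_min ltr01 divr_gt0// ?exprn_gt0//; lra.
  have f1 : f <= 1 by rewrite ge_min lexx.
  have fr : f * (8 * d + 5) <= r ^+ 2.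
    by rewrite -ler_pdivlMr ?ge_min ?lexx ?orbT//; lra.
  exists (near_min f, near_min f); first by split; exists f.
  case=> a b /= [fa fb]; rewrite -ball_normE /= nrE -eR ltcR.
  rewrite -(@ltr_pXn2r _ 2)// ?nnegrE// ?ltW//.
  have := near_minB f a b f0 fa fb; nra.
have cv := cauchy_cvg F cF.
exists (lim F).
  apply: cK => B /cv FB; have FK : F K by exists 1 => //= k [].
  exact: filter_ex (filterI FK FB).
move=> zeta Kz; rewrite !nrE lecR; apply: le_trans (dle _ Kz).
apply/ler_addgt0Pl => e e0.
have e20 : 0 < e / 2 by rewrite divr_gt0.
have : 0 < (e / 2)%:C :> R[i] by rewrite (ltcR 0).
move=> /(nbhsx_ballx (lim F))/cv[f /= f0]; rewrite -ball_normE => hf.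
have m0 : 0 < Num.min f (e / 2) by rewrite lt_min f0.
have [a [Ka ad]] := near_min0 _ m0.
have := hf a; rewrite /= nrE ltcR => /(_ _)/wrap[|al].
  split=> //; apply: lt_le_trans ad _.
  by rewrite lerD2l ge_min lexx.
have -> : xi - lim F = xi - a - (lim F - a) by rewrite opprB addrA subrK.
have : nr (xi - a - (lim F - a)) <= nr (xi - a) + nr (lim F - a).
  by rewrite -lecR rmorphD /= -!nrE ler_normB.
move=> h; apply: le_trans h _.
have : nr (xi - a) <= d + e / 2.
  by apply/ltW/(lt_le_trans ad); rewrite lerD2l ge_min lexx orbT.
by lra.
Qed.

Lemma orth_projP (xi : H) :
  K (orth_proj K xi) /\
  forall zeta, K zeta -> inner (xi - orth_proj K xi) zeta = 0.
Proof.
have [eta Keta etamin] := closest_point xi.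
(* The closest point [eta] inhabits the defining set, which excludes the default value of [xget];
   its orthogonality is minimality along the line through [eta] in direction [zeta]. *)
rewrite /orth_proj; case: xgetP => [y _ //|/(_ eta) []]; split=> // zeta Kzeta.
apply: min_norm_orthogonal => c.
rewrite -addrA -[- eta + _]opprK opprD opprK addrC -scaleNr addrC.
by apply: etamin; rewrite addrC; exact: KP.
Qed.

(** The difference between the projection and [zeta] lies in [K], hence is orthogonal to the
    residual. *)
Lemma orth_proj_closest (xi zeta : H) : K zeta ->
  `|xi - orth_proj K xi| <= `|xi - zeta|.
Proof.
move=> Kz; have [Kp orth] := orth_projP xi.
have -> : xi - zeta = xi - orth_proj K xi + (orth_proj K xi - zeta).
  by rewrite addrA subrK.
apply: pythagoras_le; apply: orth.
by rewrite -scaleN1r addrC; exact: KP.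
Qed.

End HilbertProjection.

(** * Central vectors and direct sums *)

Section CentralVectors.
Variables (R : realType) (A : cstarAlgType R) (H : hilbertBimodule A).
Variable B : set A.

Lemma central_vectors_linear (c : R[i]) (x y : H) :
  central_vectors B H x -> central_vectors B H y ->
  central_vectors B H (c *: x + y).
Proof.
by move=> cx cy b Bb; rewrite lact_linear ract_linear cx// cy.
Qed.

Lemma central_vectors0 : central_vectors B H 0.
Proof.
move=> b _; rewrite -[0 in LHS](subrr 0) -[0 in RHS](subrr 0).
by rewrite lactB ractB !subrr.
Qed.

Lemma central_vectors_closed : closed (central_vectors B H).
Proof.
have -> : central_vectors B H =
    \bigcap_(b in B) (fun xi : H => lact b xi - ract xi b) @^-1` [set 0].
  apply/seteqP; split=> xi h b Bb /=; first by rewrite h// subrr.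
  by apply/eqP; rewrite -subr_eq0; apply/eqP; exact: h.
apply: closed_bigI => b _; apply: preimage_closed; last first.
  exact: accessible_closed_set1 (hausdorff_accessible (@norm_hausdorff _ H)) _.
by move=> xi _; apply: cvgB; [exact: lact_continuous|exact: ract_continuous].
Qed.

End CentralVectors.

(** [P xi] is orthogonal to [xi - P xi]. This yields the bound 1 for the actions of [e], as
    representations are only required to be continuous. *)
Lemma saproj_contraction (R : realType) (H : hilbertType R) (P : H -> H) :
  (forall xi, P (P xi) = P xi) ->
  (forall xi eta, inner (P xi) eta = inner xi (P eta)) ->
  {morph P : xi eta / xi - eta} ->
  forall xi, `|P xi| <= `|xi|.
Proof.
move=> PP Psa PB xi; rewrite -[in leRHS](subrKC (P xi) xi).
by apply: pythagoras_le; rewrite Psa PB PP subrr inner_conj inner0l rmorph0.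
Qed.

(** * Norm estimates and central vectors under compression *)

Section CompressionNorm.
Variables (R : realType) (A C : cstarAlgType R) (S : summand A C).
Variable H : hilbertBimodule A.
Local Notation e := (summand_one S).
Local Notation P := (compress_proj S H).

Lemma norm_lact_one (xi : H) : `|lact e xi| <= `|xi|.
Proof.
apply: saproj_contraction => [eta|eta zeta|].
- by rewrite -lactM summand_oneM.
- by rewrite inner_lact summand_one_star.
- exact: lactB.
Qed.

Lemma norm_ract_one (xi : H) : `|ract xi e| <= `|xi|.
Proof.
apply: (saproj_contraction (P := fun eta : H => ract eta e)) => [eta|eta zeta|].
- by rewrite -ractM summand_oneM.
- by rewrite inner_ract summand_one_star.
- exact: ractB.
Qed.

Lemma norm_compress (xi : H) : `|P xi| <= `|xi|.
Proof.
exact: le_trans (norm_ract_one _) (norm_lact_one _).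
Qed.

(** Compression commutes with both actions of [summand_in S x], so the left-hand commutator is a
    compression of the right-hand one, and compression is a contraction. *)
Lemma compress_commutator x (xi : H) :
  `|lact x (compressed S xi) - ract (compressed S xi) x| <=
  `|lact (summand_in S x) xi - ract xi (summand_in S x)|.
Proof.
rewrite -norm_fixval fixvalB.
rewrite compress_lactE compress_ractE fixval_compressed.
rewrite lact_compress ract_compress.
by rewrite -(zmod_morphism_linear (linproj_linear P)) norm_compress.
Qed.

(** [e] acts as the identity on [fixval eta] from both sides, so [b] acts on it through its
    component in [C]. *)
Lemma central_vectors_fixval (B : set A) (D : set C) (eta : compress S H) :
  (forall b, B b -> D (summand_out S b)) ->
  central_vectors D (compress S H) eta -> central_vectors B H (fixval eta).
Proof.
move=> BD ceta b Bb.
have -> : lact b (fixval eta) = fixval (compress_lact (summand_out S b) eta).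
  rewrite compress_lactE summand_outKr lactM.
  by rewrite -[in RHS]fixvalP lact_one_compress fixvalP.
have -> : ract (fixval eta) b = fixval (compress_ract eta (summand_out S b)).
  rewrite compress_ractE summand_outKl ractM.
  by rewrite -[in RHS]fixvalP ract_one_compress fixvalP.
by congr (fixval _); exact: (ceta _ (BD _ Bb)).
Qed.

(** Normalizing divides the commutators by [|P xi|], which is at least [r]; hence the tolerance
    [beta * r] on [xi]. *)
Lemma almost_central_compress (Q : set C) (beta r : R) (xi : H) :
  0 < r -> r%:C <= `|P xi| ->
  (forall x, Q x -> `|lact (summand_in S x) xi - ract xi (summand_in S x)| <
                    (beta * r)%:C) ->
  almost_central_unit (compress S H) Q beta
    (`|P xi|^-1 *: compressed S xi : compress S H).
Proof.
move=> r0 rP h.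
have P0 : 0 < `|P xi| by apply: lt_le_trans rP; rewrite (ltcR 0).
split; first by rewrite normrZ normfV normr_id -norm_fixval mulVf// gt_eqF.
move=> x Qx; rewrite lactZ ractZ -scalerBr normrZ normfV normr_id.
rewrite mulrC ltr_pdivrMr//.
apply: le_lt_trans (compress_commutator x xi) _; apply: lt_le_trans (h x Qx) _.
have b0 : 0 < (beta * r)%:C := le_lt_trans (normr_ge0 _) (h x Qx).
rewrite rmorphM /= ler_wpM2l//.
by move: b0; rewrite (ltcR 0) (lecR 0) pmulr_lgt0// => /ltW.
Qed.

(* When P xi is too small to be normalized, eta = 0 will do. *)
Lemma approx_central_compress (B : set A) (D : set C) (Q : set C)
    (alpha beta : R) (xi : H) :
  0 < alpha -> (forall b, B b -> D (summand_out S b)) ->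
  (forall eta : compress S H, almost_central_unit (compress S H) Q beta eta ->
     `|eta - orth_proj (central_vectors D (compress S H)) eta| < alpha%:C) ->
  `|xi| = 1 ->
  (forall x, Q x -> `|lact (summand_in S x) xi - ract xi (summand_in S x)| <
                    (beta * alpha)%:C) ->
  exists2 eta, central_vectors B H eta & `|P xi - eta| <= alpha%:C.
Proof.
move=> a0 BD hT xi1 hxi.
have aR : alpha%:C \is Num.real by rewrite ger0_real// (lecR 0) ltW.
have [aP|Pa] := real_leP aR (normr_real (P xi)); last first.
  by exists 0; [exact: central_vectors0|rewrite subr0 ltW].
have P0 : `|P xi| != 0.
  by rewrite gt_eqF//; apply: lt_le_trans aP; rewrite (ltcR 0).
set u : compress S H := `|P xi|^-1 *: compressed S xi.
have := hT u (almost_central_compress a0 aP hxi).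
set v := orth_proj _ u => uv.
have [cv _] := @orth_projP _ _ (central_vectors D (compress S H))
  (@central_vectors0 _ _ _ D) (@central_vectors_linear _ _ _ D)
  (@central_vectors_closed _ _ _ D) u.
(* The projection [v] of the normalized vector is scaled back; as [|P xi| <= 1], the error does not
   grow. *)
exists (`|P xi| *: fixval v).
  rewrite -[_ *: _]addr0; apply: central_vectors_linear.
    exact: central_vectors_fixval BD cv.
  exact: central_vectors0.
have -> : P xi - `|P xi| *: fixval v = `|P xi| *: fixval (u - v).
  by rewrite fixvalB fixvalZ scalerBr scalerA divff// scale1r fixval_compressed.
rewrite normrZ normr_id norm_fixval.
apply: le_trans (ltW uv); rewrite ler_piMl// (le_trans (norm_compress _))//.
by rewrite xi1.
Qed.

End CompressionNorm.

(** * The two summands of a direct sum *)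

Section DirectSumSummands.
Variables (R : realType) (A1 A2 : cstarAlgType R).

Definition dsum : cstarAlgType R := (A1 * A2)%type.

Let star0 (A : cstarAlgType R) : star (0 : A) = 0.
Proof.
by have := star_antilinear (-1) (0 : A) 0;
  rewrite scaler0 addr0 rmorphN rmorph1 scaleN1r addNr.
Qed.

Let in1 (x : A1) : dsum := (x, 0).
Let in2 (x : A2) : dsum := (0, x).

Let in1_linear : linear in1.
Proof. by move=> c x y; congr pair; rewrite /= scaler0 addr0. Qed.

Let in2_linear : linear in2.
Proof. by move=> c x y; congr pair; rewrite /= scaler0 addr0. Qed.

Let in1M x y : in1 (x * y) = in1 x * in1 y.
Proof. by congr pair; exact/esym/mulr0. Qed.

Let in2M x y : in2 (x * y) = in2 x * in2 y.
Proof. by congr pair; exact/esym/mulr0. Qed.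

Let in1_star x : in1 (star x) = star (in1 x).
Proof. by congr pair; rewrite /= star0. Qed.

Let in2_star x : in2 (star x) = star (in2 x).
Proof. by congr pair; rewrite /= star0. Qed.

Let in1_outl (a : dsum) : in1 a.1 = in1 1 * a.
Proof. by congr pair; [exact/esym/mul1r|exact/esym/mul0r]. Qed.

Let in1_outr (a : dsum) : in1 a.1 = a * in1 1.
Proof. by congr pair; [exact/esym/mulr1|exact/esym/mulr0]. Qed.

Let in2_outl (a : dsum) : in2 a.2 = in2 1 * a.
Proof. by congr pair; [exact/esym/mul0r|exact/esym/mul1r]. Qed.

Let in2_outr (a : dsum) : in2 a.2 = a * in2 1.
Proof. by congr pair; [exact/esym/mulr0|exact/esym/mulr1]. Qed.

Definition summand1 : summand dsum A1 :=
  @Summand R dsum A1 in1 fst in1_linear (fun _ _ _ => erefl) in1M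
    (fun _ _ => erefl) in1_star (fun _ => erefl) (fun _ => erefl)
    in1_outl in1_outr.

Definition summand2 : summand dsum A2 :=
  @Summand R dsum A2 in2 snd in2_linear (fun _ _ _ => erefl) in2M
    (fun _ _ => erefl) in2_star (fun _ => erefl) (fun _ => erefl)
    in2_outl in2_outr.

Lemma summand_one12 : summand_one summand1 + summand_one summand2 = 1.
Proof. by congr pair; [exact: addr0|exact: add0r]. Qed.

Variable H : hilbertBimodule dsum.
Local Notation e1 := (summand_one summand1).

(* With c = e1 xi - xi e1, the off-diagonal part of xi is e1 c - c e1. *)
Lemma norm_off_diagonal (xi : H) :
  `|xi - (compress_proj summand1 H xi + compress_proj summand2 H xi)| <=
  2 * `|lact e1 xi - ract xi e1|.
Proof.
set c := lact e1 xi - ract xi e1.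
have e2E : summand_one summand2 = 1 - e1.
  by rewrite -summand_one12 addrC addrA addNr add0r.
have lactBl (a b : dsum) (eta : H) : lact (a - b) eta = lact a eta - lact b eta.
  exact: (zmod_morphism_linear (lact_linearl eta)).
have ractBr (a b : dsum) (eta : H) : ract eta (a - b) = ract eta a - ract eta b.
  exact: (zmod_morphism_linear (ract_linearr eta)).
(* Since [e2 = 1 - e1], both sides are [e1 xi + xi e1 - 2 e1 xi e1]. *)
have -> : xi - (compress_proj summand1 H xi + compress_proj summand2 H xi) =
    lact e1 c - ract c e1.
  rewrite !compressE e2E lactBl lact1 ractBr ract1 ractB /c lactB ractB.
  rewrite -lactM -ractM summand_oneM lact_ractC.
  set u := lact e1 xi; set v := ract xi e1; set w := ract u e1.
  rewrite !opprD !opprK !addrA.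
  by rewrite [xi - w]addrC addrK [- w + u]addrC addrAC.
apply: le_trans (ler_normB _ _) _; rewrite mulr_natl mulr2n lerD//.
- exact: norm_lact_one.
- exact: norm_ract_one.
Qed.

End DirectSumSummands.

(** * Both properties for the direct sum *)

Section DirectSumPropertyT.
Variables (R : realType) (A1 A2 : cstarAlgType R) (B1 : set A1) (B2 : set A2).
Local Notation S1 := (summand1 A1 A2).
Local Notation S2 := (summand2 A1 A2).
Local Notation A := (dsum A1 A2).

(** [e1] controls the off-diagonal part of a vector; the two images control the commutators of its
    compressions. *)
Definition joint_set (Q1 : set A1) (Q2 : set A2) : set A :=
  [set summand_one S1] `|` (summand_in S1 @` Q1 `|` summand_in S2 @` Q2).

Lemma finite_joint_set Q1 Q2 :
  finite_set Q1 -> finite_set Q2 -> finite_set (joint_set Q1 Q2).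
Proof.
move=> f1 f2; rewrite finite_setU; split; first exact: finite_set1.
by rewrite finite_setU; split; exact: finite_image.
Qed.

Lemma joint_set_nonempty Q1 Q2 : joint_set Q1 Q2 !=set0.
Proof. by exists (summand_one S1); left. Qed.

Lemma property_T_dsum : property_T B1 -> property_T B2 ->
  property_T (B1 `*` B2 : set A).
Proof.
move=> [F1 [d1 [fF1 _ d10 T1]]] [F2 [d2 [fF2 _ d20 T2]]].
(* The unit norm is split as [2/4 + 1/4 + 1/4]: twice the commutator with [e1], then the two
   compressions. A compression of norm at least [1/4] can be normalized, which requires the
   tolerances [d1 / 4] and [d2 / 4]. *)
pose d := Num.min 4^-1 (Num.min (d1 / 4) (d2 / 4)).
have d0 : 0 < d by rewrite !lt_min invr_gt0 !divr_gt0// ltr0n.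
exists (joint_set F1 F2), d; split=> //.
- exact: finite_joint_set.
- exact: joint_set_nonempty.
move=> H [xi [xi1 xiF]] H0.
(* [H0] assumes that [H] has no nonzero central vector; then a compression has none either. *)
have no_central C (S : summand A C) (D : set C) :
    (forall b, (B1 `*` B2) b -> D (summand_out S b)) ->
    central_vectors D (compress S H) = [set 0].
  move=> BD; apply/seteqP; split=> eta /=; last first.
    by move=> ->; exact: central_vectors0.
  move=> /(central_vectors_fixval BD); rewrite H0 => eta0.
  apply: fixval_inj; rewrite eta0.
  by rewrite -[in RHS](subrr 0) fixvalB subrr.
(* Otherwise the normalized compression would be almost central, and property (T) of the summand
   would contradict [no_central]. *)
have small C (S : summand A C) (Q : set C) (g : R) (D : set C) :
    (forall x, Q x -> joint_set F1 F2 (summand_in S x)) -> d <= g / 4 ->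
    (forall b, (B1 `*` B2) b -> D (summand_out S b)) ->
    (forall K : hilbertBimodule C, almost_central_unit K Q g !=set0 ->
       central_vectors D K <> [set 0]) ->
    `|compress_proj S H xi| < (4^-1)%:C.
  move=> QF dg BD hT; rewrite real_ltNge ?normr_real//; last first.
    by rewrite ger0_real// (lecR 0) invr_ge0.
  apply/negP => Pxi; apply: (hT (compress S H)); last exact: no_central.
  eexists; apply: (almost_central_compress _ Pxi); first by rewrite invr_gt0.
  by move=> x Qx; apply: lt_le_trans (xiF _ (QF _ Qx)) _; rewrite lecR.
have s1 := small _ S1 F1 d1 B1 _ _ _ T1.
have s2 := small _ S2 F2 d2 B2 _ _ _ T2.
have : `|compress_proj S1 H xi| < (4^-1)%:C.
  apply: s1; first by move=> x Qx; right; left; exists x.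
  - by rewrite !ge_min lexx !orbT.
  - by move=> b [].
have : `|compress_proj S2 H xi| < (4^-1)%:C.
  apply: s2; first by move=> x Qx; right; right; exists x.
  - by rewrite !ge_min lexx !orbT.
  - by move=> b [].
have e1xi : `|lact (summand_one S1) xi - ract xi (summand_one S1)| < (4^-1)%:C.
  apply: lt_le_trans (xiF _ _) _; first by left.
  by rewrite lecR ge_min lexx.
have off := norm_off_diagonal xi.
move=> P2 P1.
have : `|xi| < 1.
  rewrite -[xi in ltLHS](subrK (compress_proj S1 H xi + compress_proj S2 H xi)).
  apply: le_lt_trans (ler_normD _ _) _.
  have := le_lt_trans (ler_normD _ _) (ltrD P1 P2).
  have -> : 1 = 2 * (4^-1)%:C + ((4^-1)%:C + (4^-1)%:C) :> R[i].
    rewrite mulr_natl mulr2n -!rmorphD /= -[LHS](rmorph1 (real_complex R)).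
    by congr (_%:C); lra.
  apply: ler_ltD; apply: le_trans off _.
  by rewrite ler_wpM2l// ltW.
by rewrite xi1 ltxx.
Qed.

Lemma strong_property_T_dsum : strong_property_T B1 -> strong_property_T B2 ->
  strong_property_T (B1 `*` B2 : set A).
Proof.
move=> T1 T2 alpha alpha0.
(* [alpha / 8] is at once the accuracy in each corner, the threshold for normalizing and the
   tolerance for [e1]; the total error [2 (alpha / 8) + alpha / 8 + alpha / 8] is half of
   [alpha]. *)
have a0 : 0 < alpha / 8 by rewrite divr_gt0.
have [Q1 [b1 [fQ1 _ b10 {}T1]]] := T1 _ a0.
have [Q2 [b2 [fQ2 _ b20 {}T2]]] := T2 _ a0.
pose b := Num.min (alpha / 8) (Num.min (b1 * (alpha / 8)) (b2 * (alpha / 8))).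
have b0 : 0 < b by rewrite !lt_min a0 !mulr_gt0.
exists (joint_set Q1 Q2), b; split=> //.
- exact: finite_joint_set.
- exact: joint_set_nonempty.
move=> H xi [xi1 xiQ].
have [eta1 c1 P1] : exists2 eta, central_vectors (B1 `*` B2 : set A) H eta &
    `|compress_proj S1 H xi - eta| <= (alpha / 8)%:C.
  apply: (approx_central_compress a0 _ (T1 _) xi1); first by move=> x [].
  move=> x Qx; apply: lt_le_trans (xiQ _ _) _; first by right; left; exists x.
  by rewrite lecR !ge_min lexx !orbT.
have [eta2 c2 P2] : exists2 eta, central_vectors (B1 `*` B2 : set A) H eta &
    `|compress_proj S2 H xi - eta| <= (alpha / 8)%:C.
  apply: (approx_central_compress a0 _ (T2 _) xi1); first by move=> x [].
  move=> x Qx; apply: lt_le_trans (xiQ _ _) _; first by right; right; exists x.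
  by rewrite lecR !ge_min lexx !orbT.
have e1xi : `|lact (summand_one S1) xi - ract xi (summand_one S1)| <=
    (alpha / 8)%:C.
  apply/ltW/(lt_le_trans (xiQ _ _)); first by left.
  by rewrite lecR ge_min lexx.
have c12 : central_vectors (B1 `*` B2 : set A) H (eta1 + eta2).
  by rewrite -[eta1]scale1r; exact: central_vectors_linear.
apply: le_lt_trans (orth_proj_closest (@central_vectors0 _ _ _ _)
  (@central_vectors_linear _ _ _ _) (@central_vectors_closed _ _ _ _) xi c12) _.
have off := norm_off_diagonal xi.
have -> : xi - (eta1 + eta2) =
    xi - (compress_proj S1 H xi + compress_proj S2 H xi) +
    ((compress_proj S1 H xi - eta1) + (compress_proj S2 H xi - eta2)).
  by rewrite [_ - _ + (_ - eta2)]addrACA -opprD addrA subrK.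
apply: le_lt_trans (ler_normD _ _) _.
have h := le_trans (ler_normD _ _) (lerD P1 P2).
have h' : `|xi - (compress_proj S1 H xi + compress_proj S2 H xi)| <=
    2 * (alpha / 8)%:C by apply: le_trans off _; rewrite ler_wpM2l.
apply: le_lt_trans (lerD h' h) _.
rewrite mulr_natl mulr2n -!rmorphD /= ltcR.
by lra.
Qed.

End DirectSumPropertyT.

Theorem lemma4p2 (R : realType) (A1 A2 : cstarAlgType R)
    (B1 : set A1) (B2 : set A2)
    (hB1 : unital_cstar_subalgebra B1) (hB2 : unital_cstar_subalgebra B2) :
  (property_T B1 -> property_T B2 -> property_T (B1 `*` B2)) /\
  (strong_property_T B1 -> strong_property_T B2 ->
   strong_property_T (B1 `*` B2)).
Proof.
by split; [exact: property_T_dsum|exact: strong_property_T_dsum].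
Qed.
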